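(* Let $T$ be a tree of order $n\geq 2$ and let $F\subseteq V(T)$ be a minimal fort of $T$. Let $u,v\in F$ and let $W=\{w_{0},w_{1},\ldots,w_{\ell}\}$ be the vertex set of the unique path from $u$ to $v$ in $T$. Then the induced subgraph $T[W]$ is a path graph of order $\ell+1$, and $F\cap W$ is a minimal fort of $T[W]$.
   Context: A fort of a finite simple graph $G=(V,E)$ is a non-empty subset $F\subseteq V$ such that no vertex $u\in V\setminus F$ has exactly one neighbor in $F$; a fort is minimal if no proper subset of it is a fort. *)

(* Defs.v *)
From mathcomp Require Import all_boot.

Set Implicit Arguments.
Unset Strict Implicit.
Unset Printing Implicit Defensive.

Record sgraph := SGraph {
  vertex :> finType;
  edge : rel vertex;
  edge_sym : symmetric edge;
  edge_irr : irreflexive edge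
}.

Definition neighbors (G : sgraph) (x : G) : {set G} := [set y | edge x y].

Definition fort (G : sgraph) (F : {set G}) : bool :=
  (F != set0) && [forall u, (u \notin F) ==> (#|neighbors u :&: F| != 1)].

(* [minset fort F]: F is a fort and no proper subset of F is a fort. *)
Definition minimal_fort (G : sgraph) (F : {set G}) : bool :=
  minset (@fort G) F.

Definition connected_graph (G : sgraph) : Prop :=
  0 < #|G| /\ forall x y : G, connect (@edge G) x y.

(* The bound on the size is needed because [:: x; y] is a [ucycle] as soon as
   xy is an edge, and [::] is always one. *)
Definition acyclic_graph (G : sgraph) : Prop :=
  forall c : seq G, 3 <= size c -> ~ ucycle (@edge G) c.

Definition tree (G : sgraph) : Prop := connected_graph G /\ acyclic_graph G.

(* The vertices of the path are, in order, those of u :: p, so its length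
   (number of edges) is size p; u = v is allowed, and then p = [::]. *)
Definition path_between (G : sgraph) (u v : G) (p : seq G) : Prop :=
  [/\ path (@edge G) u p, last u p = v & uniq (u :: p)].

Section Induced.
Variables (G : sgraph) (W : {set G}).

Definition induced_edge : rel {x : G | x \in W} :=
  fun x y => edge (val x) (val y).

Fact induced_edge_sym : symmetric induced_edge.
Proof. by move=> x y; apply: edge_sym. Qed.

Fact induced_edge_irr : irreflexive induced_edge.
Proof. by move=> x; apply: edge_irr. Qed.

Definition induced : sgraph := SGraph induced_edge_sym induced_edge_irr.

(* F :&: W, viewed as a set of vertices of the induced subgraph on W. *)
Definition restrict_set (F : {set G}) : {set induced} :=
  [set x : induced | val x \in F :&: W].
End Induced.

Section PathGraph.
Variable n : nat.

Definition path_graph_edge : rel 'I_n :=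
  fun i j => (i.+1 == j) || (j.+1 == i).

Fact path_graph_edge_sym : symmetric path_graph_edge.
Proof. by move=> i j; rewrite /path_graph_edge orbC. Qed.

Fact path_graph_edge_irr : irreflexive path_graph_edge.
Proof. by move=> i; rewrite /path_graph_edge orbb -[X in _ == X]addn0 -addn1 eqn_add2l. Qed.

Definition path_graph : sgraph :=
  SGraph path_graph_edge_sym path_graph_edge_irr.
End PathGraph.

Definition graph_iso (G H : sgraph) : Prop :=
  exists2 f : G -> H,
    bijective f & forall x y : G, edge (f x) (f y) = edge x y.

(* Main.v *)
Require Import Defs.
From mathcomp Require Import all_boot.
From mathcomp Require Import zify.

(** Write the path as [w_0 ... w_l].  If [C] is a union of components of
    [T - b], one for each vertex of a set [A] of neighbours of [b], then
    [F :&: C] is a fort as soon as [b] has not exactly one neighbour in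
    [A :&: F] and either [b] lies outside [F] or [A] lies inside [F].  By
    minimality [F] is then contained in [C].  Taking [b = w_(i+1)] and
    [A = {w_i}] shows that no two consecutive [w_i] lie outside [F]; taking
    [b = w_(i+1)] and [A = {w_i, w_(i+2)}] shows that no three consecutive
    [w_i] lie in [F].  Since both ends are in [F], these two conditions say
    that [F] restricts to a minimal fort of the path. *)

Set Implicit Arguments.
Unset Strict Implicit.
Unset Printing Implicit Defensive.

(** * Components of a graph with one vertex deleted *)

Definition edge_avoiding (G : sgraph) (b : G) : rel G :=
  fun x y => [&& edge x y, x != b & y != b].

Lemma connect_avoiding_sym (G : sgraph) (b : G) :
  connect_sym (edge_avoiding b).
Proof.
apply: sym_connect_sym => x y.
by rewrite /edge_avoiding edge_sym [(x != b) && _]andbC.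
Qed.

(** Otherwise a simple path from [x] to [y] avoiding [b], closed up through [b], would be a cycle of
    length at least 3. *)
Lemma acyclic_neighbor_inj (G : sgraph) (b x y : G) :
  acyclic_graph G -> edge b x -> edge b y ->
  connect (edge_avoiding b) x y -> x = y.
Proof.
move=> acG bx by_ /connectP[q0 pq0 ey]; move: by_; rewrite {}ey.
case/shortenP: pq0 => -[|z q] //= /andP[xz pq] uq _ by_.
case: (acG [:: b, x, z & q]) => //.
have pe : path (@edge G) x (z :: q).
  by apply: (@sub_path _ (edge_avoiding b)); [move=> s t /and3P[] | rewrite /= xz].
have nb : b \notin [:: x, z & q].
  have [_ xb zb] := and3P xz.
  rewrite !inE !negb_or ![b == _]eq_sym xb zb /=.
  elim: q z {xz zb uq by_ pe} pq => //= s q IH z /andP[/and3P[_ _ sb] pq].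
  by rewrite inE negb_or eq_sym sb (IH s).
rewrite /ucycle [uniq _]cons_uniq nb /= bx rcons_path uq.
by move: pe => /= /andP[-> ->]; rewrite edge_sym by_.
Qed.

(** The only edges leaving [C] join [b] to vertices of [A]. So [b] sees [A :&: F] in [F :&: C], any
    other vertex outside [C] sees nothing there, and a vertex of [C] outside [F] sees the same as in
    [F]. The vertex [z0] makes [F :&: C] non-empty. *)
Lemma minimal_fort_sub_component (G : sgraph) (F A : {set G}) (b z0 : G)
    (C := [set z | (z != b) && [exists a in A, connect (edge_avoiding b) a z]]) :
  acyclic_graph G -> minimal_fort F -> A \subset neighbors b ->
  (b \notin F) || (A \subset F) -> #|A :&: F| != 1 -> z0 \in F -> z0 \in C ->
  F \subset C.
Proof.
move=> acG /minsetP[fortF minF] Ab bA cardA z0F z0C.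
have C_closed x y : x \in C -> edge x y -> y != b -> y \in C.
  rewrite !inE => /andP[xb /exists_inP[a aA ax]] xy yb; rewrite yb.
  apply/exists_inP; exists a => //; apply: connect_trans ax _.
  by apply: connect1; rewrite /edge_avoiding xy xb yb.
(* By acyclicity, each component of [G - b] contains at most one neighbour of [b]. *)
have C_nbr x : edge b x -> x \in C -> x \in A.
  move=> bx; rewrite inE => /andP[xb /exists_inP[a aA ax]].
  rewrite -(acyclic_neighbor_inj acG _ bx ax) //.
  by have := subsetP Ab _ aA; rewrite inE.
have A_C x : x \in A -> x \in C.
  move=> xA; rewrite inE; apply/andP; split.
    have := subsetP Ab _ xA; rewrite inE => bx.
    by apply: contraTneq bx => ->; rewrite edge_irr.
  by apply/exists_inP; exists x.
suff fortC : fort (F :&: C).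
  by rewrite -(minF _ fortC (subsetIl _ _)) subsetIr.
rewrite /fort; apply/andP; split.
  by apply/set0Pn; exists z0; rewrite inE z0F.
apply/forallP=> x; apply/implyP => xFC.
have [->|xb] := eqVneq x b.
  suff -> : neighbors b :&: (F :&: C) = A :&: F by [].
  apply/setP => y; rewrite !in_setI.
  have [yA|yA] := boolP (y \in A).
    by rewrite (subsetP Ab _ yA) (A_C _ yA) andbT.
  by apply/and3P => -[]; rewrite inE => h _ /(C_nbr _ h); rewrite (negPf yA).
have [xC|xC] := boolP (x \in C); last first.
  suff -> : neighbors x :&: (F :&: C) = set0 by rewrite cards0.
  apply/setP => y; rewrite !in_setI in_set0; apply/and3P => -[].
  rewrite inE edge_sym => yx _ yC.
  by move: (C_closed _ _ yC yx xb); rewrite (negPf xC).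
have xF : x \notin F by move: xFC; rewrite in_setI xC andbT.
suff -> : neighbors x :&: (F :&: C) = neighbors x :&: F.
  by have /andP[_ /forallP/(_ x)/implyP/(_ xF)] := fortF.
apply/setP => y; rewrite !in_setI.
have [xy|] //= := boolP (y \in neighbors x); rewrite inE in xy.
have [yF|] //= := boolP (y \in F).
(* A neighbour [y = b] in [F] would put [x] in [A], hence in [F]. *)
apply: (C_closed x) => //; apply: contraTneq bA => yb.
rewrite -yb yF /=; apply/negP => /subsetP/(_ x) AF.
by move: xF; rewrite AF // C_nbr // edge_sym -yb.
Qed.

(** * Invariance of forts under isomorphism *)

Lemma fort_preim (G H : sgraph) (f : G -> H) (A : {set H}) :
  bijective f -> (forall x y, edge (f x) (f y) = edge x y) ->
  fort (f @^-1: A) = fort A.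
Proof.
move=> bij_f ef; have [g fK gK] := bij_f.
congr (~~ _ && _).
  apply/eqP/eqP => [/setP E|->]; last exact: preimset0.
  by apply/setP => y; have := E (g y); rewrite !inE gK.
have card_nbr x : #|neighbors x :&: f @^-1: A| = #|neighbors (f x) :&: A|.
  have -> : neighbors x :&: f @^-1: A = f @^-1: (neighbors (f x) :&: A).
    by apply/setP => y; rewrite !inE ef.
  by rewrite on_card_preimset //; apply: onW_bij.
apply/forallP/forallP => E x; last by rewrite card_nbr inE.
by have := E (g x); rewrite card_nbr inE gK.
Qed.

Lemma minimal_fort_preim (G H : sgraph) (f : G -> H) (A : {set H}) :
  bijective f -> (forall x y, edge (f x) (f y) = edge x y) ->
  minimal_fort A -> minimal_fort (f @^-1: A).
Proof.
move=> bij_f ef /minsetP[fA minA]; have [g fK gK] := bij_f.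
apply/minsetP; split=> [|B fB BA]; first by rewrite fort_preim.
have eB : B = f @^-1: (g @^-1: B) by apply/setP => x; rewrite !inE fK.
rewrite eB in fB *; rewrite (minA (g @^-1: B)) // -?(fort_preim _ bij_f ef) //.
apply/subsetP => y; rewrite inE => /(subsetP BA).
by rewrite inE gK.
Qed.

(** * Forts of a path graph *)

Section PathForts.
Variable m : nat.
Implicit Types A B : {set path_graph m.+1}.

(* Membership shifted by one, so that the positions [0] and [m.+2] just beyond
   both ends of the path count as non-members. *)
Definition shifted_mem B (k : nat) : bool :=
  if k is k'.+1 then (k' <= m) && ((inord k' : 'I_m.+1) \in B) else false.

Lemma shifted_memS B (i : 'I_m.+1) : shifted_mem B i.+1 = (i \in B).
Proof. by rewrite /= -ltnS ltn_ord inord_val. Qed.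

Lemma shifted_mem_inP B k :
  shifted_mem B k -> exists2 i : 'I_m.+1, k = i.+1 & i \in B.
Proof.
case: k => //= k /andP[km kB]; exists (inord k) => //.
by rewrite inordK.
Qed.

(** Vertex [k] sits at position [k.+1], so its neighbours are at positions [k] and [k.+2]; the
    padding covers the two ends of the path. *)
Lemma fort_shifted_mem_step B k :
  fort B -> k <= m -> ~~ shifted_mem B k.+1 ->
  shifted_mem B k = shifted_mem B k.+2.
Proof.
move=> /andP[_ /forallP fB] km kB.
have kE : (inord k : 'I_m.+1) = k :> nat by rewrite inordK.
have {fB} := fB (inord k); rewrite -shifted_memS kE kB implyTb.
(* Here [a] and [c] are the two neighbouring positions in either order, so that both asymmetric
   cases are covered. *)
have one (a c : nat) : (forall l, (l == k) || (l == k.+2) = (l == a) || (l == c)) ->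
    shifted_mem B a -> ~~ shifted_mem B c ->
    #|neighbors (inord k : path_graph m.+1) :&: B| == 1.
  move=> ac aB cB; have [i ai iB] := shifted_mem_inP aB.
  apply/cards1P; exists i; apply/setP => j.
  have -> : (j \in neighbors (inord k : path_graph m.+1) :&: B) =
      ((j.+1 == a) || (j.+1 == c)) && shifted_mem B j.+1.
    rewrite -ac !inE -shifted_memS /= /path_graph_edge kE.
    by rewrite -[k.+1 == j]eqSS [k.+2 == _]eq_sym orbC.
  rewrite in_set1 ai eqSS val_eqE; have [->|_] := eqVneq j i.
    by rewrite shifted_memS iB.
  by apply/andP => -[/eqP ->]; rewrite (negPf cB).
apply: contraNeq; case ak: (shifted_mem B k); case ck: (shifted_mem B k.+2) => // _.
  by apply: (one k k.+2); rewrite ?ak ?ck.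
by apply: (one k.+2 k); rewrite ?ak ?ck // => l; rewrite orbC.
Qed.

(** Two consecutive non-members propagate in both directions and would make [B] empty. *)
Lemma fort_shifted_mem B k :
  fort B -> k <= m.+1 -> shifted_mem B k || shifted_mem B k.+1.
Proof.
move=> fB km; apply: contraTT (fB); rewrite negb_or => /andP[h0 h1].
have up j : ~~ shifted_mem B (k + j) && ~~ shifted_mem B (k + j).+1.
  elim: j => [|j /andP[IH0 IH1]]; first by rewrite addn0 h0 h1.
  rewrite addnS IH1 andTb; have [le|lt] := leqP (k + j) m.
    by rewrite -(fort_shifted_mem_step fB le IH1).
  by apply/negP => /= /andP[]; lia.
have down j : j <= k -> ~~ shifted_mem B (k - j) && ~~ shifted_mem B (k - j).+1.
  elim: j => [|j IH] jk; first by rewrite subn0 h0 h1.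
  have /andP[IH0 IH1] := IH (ltnW jk).
  have e : k - j = (k - j.+1).+1 by lia.
  rewrite e in IH0 IH1; rewrite IH0 andbT (fort_shifted_mem_step fB) //; lia.
rewrite /fort negb_and negbK; apply/orP; left; apply/eqP/setP => i.
rewrite in_set0 -shifted_memS; apply/negbTE.
have [le|/ltnW le] := leqP k i.+1.
  by have /andP[] := up (i.+1 - k); rewrite subnKC.
by have /andP[] := down (k - i.+1) (leq_subr _ _); rewrite subKn.
Qed.

(** A vertex outside [A] is interior and has both neighbours in [A]. If a fort [B] inside [A] missed
    some [i] of [A], then [i] would be interior and both its neighbours would lie in [B], giving
    three consecutive members of [A]. *)
Lemma minimal_fort_path_graph A :
  ord0 \in A -> ord_max \in A ->
  (forall i j : 'I_m.+1, j = i.+1 :> nat -> (i \in A) || (j \in A)) ->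
  (forall i j k : 'I_m.+1, j = i.+1 :> nat -> k = j.+1 :> nat ->
     ~~ [&& i \in A, j \in A & k \in A]) ->
  minimal_fort A.
Proof.
move=> A0 Am pairA tripleA.
have interior (i : 'I_m.+1) : i != ord0 -> i != ord_max ->
    exists j k : 'I_m.+1, i = j.+1 :> nat /\ k = i.+1 :> nat.
  rewrite -!val_eqE /= => i0 im; have lt := ltn_ord i.
  by exists (inord i.-1), (inord i.+1); rewrite !inordK; lia.
apply/minsetP; split=> [|B fB BA].
  apply/andP; split; first by apply/set0Pn; exists ord0.
  apply/forallP=> i; apply/implyP => iA.
  have [] := interior i; try by apply: contraNneq iA => ->.
  move=> j [k [ij ki]]; rewrite neq_ltn; apply/orP; right; apply/card_gt1P.
  have := pairA _ _ ij; have := pairA _ _ ki; rewrite (negPf iA) orbF /= => kA jA.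
  exists j, k; split; last by apply/eqP => jk; move: ki; rewrite -jk ij; lia.
    by rewrite !inE /= /path_graph_edge jA ij eqxx orbT.
  by rewrite !inE /= /path_graph_edge kA ki eqxx.
apply/eqP; rewrite eqEsubset BA; apply/subsetP => i iA; apply/negPn/negP => iB.
have [] := interior i.
(* Position [0] is padding, so [B] contains the first vertex; position [m.+2] gives the last one in
   the same way. *)
- apply: contraNneq iB => ->.
  by have := fort_shifted_mem fB (leq0n m.+1); rewrite -shifted_memS.
- apply: contraNneq iB => ->.
  have := fort_shifted_mem fB (leqnn m.+1); rewrite -shifted_memS.
  by case/orP => // /andP[]; rewrite ltnn.
move=> j [k [ij ki]].
have := tripleA _ _ _ ij ki; rewrite iA /=.
have lt := ltn_ord k.
rewrite !(subsetP BA) //.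
- have := fort_shifted_mem fB (_ : i.+1 <= m.+1).
  by rewrite -ki !shifted_memS ki shifted_memS (negPf iB) /=; apply.
- have := fort_shifted_mem fB (_ : j.+1 <= m.+1).
  by rewrite -ij !shifted_memS ij shifted_memS (negPf iB) orbF; apply; lia.
Qed.

End PathForts.

(** * Paths in an acyclic graph *)

Section TreePath.
Variables (T : sgraph) (u : T) (p : seq T).
Hypotheses (acT : acyclic_graph T) (pT : path (@edge T) u p) (up : uniq (u :: p)).
Local Notation w := (nth u (u :: p)).

Lemma path_nth_eq i j : i <= size p -> j <= size p -> (w i == w j) = (i == j).
Proof. by move=> ip jp; rewrite nth_uniq. Qed.

Lemma path_nth_edge i : i < size p -> edge (w i) (w i.+1).
Proof. by move=> ip; have /(pathP u)/(_ i ip) := pT. Qed.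

Lemma path_nth_connect b i j : i <= j <= size p -> b <= size p ->
  (b < i) || (j < b) -> connect (edge_avoiding (w b)) (w i) (w j).
Proof.
move=> /andP[]; elim: j => [|j IH] ij jp bp bij.
  by move: ij; rewrite leqn0 => /eqP ->.
have [<-//|ne] := eqVneq i j.+1.
apply: (connect_trans (y := w j)); first by apply: IH; lia.
apply: connect1; rewrite /edge_avoiding path_nth_edge //.
by rewrite !path_nth_eq; lia.
Qed.

(** There are no chords: [w i.+1] and [w j] would be two neighbours of [w i] joined by a stretch of
    the path avoiding [w i]. *)
Lemma path_nth_edge_lt i j : i < j -> j <= size p ->
  edge (w i) (w j) = (i.+1 == j).
Proof.
move=> ij jp; apply/idP/eqP => [wij|<-]; last by apply: path_nth_edge; lia.
have wi : edge (w i) (w i.+1) by apply: path_nth_edge; lia.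
apply/eqP; rewrite -path_nth_eq //; last by lia.
apply/eqP; apply: (acyclic_neighbor_inj acT wi wij).
by apply: path_nth_connect; lia.
Qed.

Lemma path_nth_edgeE i j : i <= size p -> j <= size p ->
  edge (w i) (w j) = (i.+1 == j) || (j.+1 == i).
Proof.
move=> ip jp; have [lt|lt|->] := ltngtP i j.
- by rewrite path_nth_edge_lt //; lia.
- by rewrite edge_sym path_nth_edge_lt //; lia.
- by rewrite edge_irr; lia.
Qed.

Lemma minimal_fort_path_pair (F : {set T}) i :
  minimal_fort F -> u \in F -> last u p \in F -> i < size p ->
  (w i \in F) || (w i.+1 \in F).
Proof.
move=> minF uF; rewrite (last_nth u) => vF ip; apply/norP => -[iF iF'].
(* The last vertex is in [F], so the path continues to [w i.+2]. *)
have ne : i.+1 != size p by apply: contraNneq iF' => ->.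
have wi : edge (w i.+1) (w i) by rewrite path_nth_edgeE; lia.
have wi' : edge (w i.+1) (w i.+2) by rewrite path_nth_edgeE; lia.
have : F \subset [set z | (z != w i.+1) &&
    [exists a in [set w i], connect (edge_avoiding (w i.+1)) a z]].
  apply: (minimal_fort_sub_component (z0 := w 0)) => //.
  - by rewrite sub1set inE.
  - by rewrite iF'.
  - suff -> : [set w i] :&: F = set0 by rewrite cards0.
    by apply/setP => z; rewrite !inE; apply/andP => -[/eqP ->]; apply/negP.
  - rewrite inE path_nth_eq; [|lia..]; apply/andP; split=> //.
    apply/exists_inP; exists (w i); first exact: set11.
    by rewrite connect_avoiding_sym path_nth_connect; lia.
move=> /subsetP/(_ _ vF); rewrite inE => /andP[_ /exists_inP[a /set1P -> av]].
(* The end of the path lies in the component of [w i] by the inclusion just obtained, and in that of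
   [w i.+2] along the path. *)
have : connect (edge_avoiding (w i.+1)) (w i) (w i.+2).
  apply: connect_trans av _; rewrite connect_avoiding_sym.
  by apply: path_nth_connect; lia.
move=> /(acyclic_neighbor_inj acT wi wi')/eqP.
by rewrite path_nth_eq; lia.
Qed.

(** Otherwise [F] would lie in components of [T - w i.+1], although it contains [w i.+1]. *)
Lemma minimal_fort_path_triple (F : {set T}) i :
  minimal_fort F -> i.+1 < size p ->
  ~~ [&& w i \in F, w i.+1 \in F & w i.+2 \in F].
Proof.
move=> minF ip; apply/and3P => -[F0 F1 F2].
have : F \subset [set z | (z != w i.+1) && [exists a in [set w i; w i.+2],
    connect (edge_avoiding (w i.+1)) a z]].
  have sub : [set w i; w i.+2] \subset F by rewrite subUset !sub1set F0 F2.
  apply: (minimal_fort_sub_component (z0 := w i)) => //.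
  - by rewrite subUset !sub1set !inE !path_nth_edgeE; lia.
  - by rewrite sub orbT.
  - by rewrite (setIidPl sub) cards2 path_nth_eq; lia.
  - rewrite inE path_nth_eq; [|lia..]; apply/andP; split; first lia.
    by apply/exists_inP; exists (w i); rewrite ?set21.
by move=> /subsetP/(_ _ F1); rewrite inE eqxx.
Qed.

End TreePath.

Theorem theorem4p10 (n : nat) (T : sgraph) (F : {set T}) (u v : T)
    (p : seq T) (W : {set T}) :
  2 <= n -> #|T| = n -> tree T ->
  minimal_fort F -> u \in F -> v \in F ->
  path_between u v p -> W = [set x in u :: p] ->
  graph_iso (induced W) (path_graph (size p).+1) /\
  minimal_fort (restrict_set W F).
Proof.
move=> _ _ [_ acT] minF uF vF [pT ev up] eW.
have WP x : (x \in W) = (x \in u :: p) by rewrite eW inE.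
have wW (i : 'I_(size p).+1) : nth u (u :: p) i \in W by rewrite WP mem_nth.
(* The isomorphism sends a vertex to its index on the path; membership in [W] keeps [inord] away
   from its default value. *)
pose f (x : induced W) : path_graph (size p).+1 := inord (index (val x) (u :: p)).
have fE x : f x = index (val x) (u :: p) :> nat.
  by rewrite /f inordK // index_mem -WP (valP x).
have wf x : nth u (u :: p) (f x) = val x by rewrite fE nth_index // -WP (valP x).
have bij_f : bijective f.
  exists (fun i : 'I_(size p).+1 => exist _ (nth u (u :: p) i) (wW i)) => [x|i]; apply: val_inj.
    exact: wf.
  by apply: etrans (fE _) _; rewrite index_uniq.
have ef x y : edge (f x) (f y) = edge x y.
  by rewrite /= /induced_edge -!wf path_nth_edgeE // -ltnS ltn_ord.
split; first by exists f.
have -> : restrict_set W F = f @^-1: [set i : 'I_(size p).+1 | nth u (u :: p) i \in F].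
  by apply/setP => x; rewrite !inE (valP x) andbT wf.
apply: minimal_fort_preim => //; apply: minimal_fort_path_graph.
- by rewrite inE.
- by rewrite inE -last_nth ev.
- move=> i j ij; rewrite !inE ij minimal_fort_path_pair ?ev //.
  by rewrite -ltnS -ij.
- move=> i j k ij jk; rewrite !inE jk ij minimal_fort_path_triple //.
  by rewrite -ltnS -ij -jk.
Qed.
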